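(* For finite groups $G$ and $H$, $$\omega(G\times H)=\{\operatorname{lcm}(a,b): a\in\omega(G),\ b\in\omega(H)\},$$ so $\max\{\eta(G),\eta(H)\}\le\eta(G\times H)\le\eta(G)\,\eta(H)$; and if $\gcd(|G|,|H|)=1$, then $\eta(G\times H)=\eta(G)\,\eta(H)$.
   Context: For a finite group $G$, $\omega(G)$ denotes the set of orders of elements of $G$ and $\eta(G)=|\omega(G)|$. *)

(* Defs.v *)
From mathcomp Require Import all_boot all_fingroup.
From mathcomp Require Import finmap.

Set Implicit Arguments.
Unset Strict Implicit.
Unset Printing Implicit Defensive.

Definition omega (gT : finGroupType) (G : {group gT}) : {fset nat} :=
  [fset #[x]%g | x in G]%fset.

Definition eta (gT : finGroupType) (G : {group gT}) : nat := #|` omega G|.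

(* Main.v *)
Require Import Defs.
From mathcomp Require Import all_boot all_fingroup.
From mathcomp Require Import finmap cyclic.

(** The order of [(x, y)] is the lcm of the orders of [x] and [y], because a
    power of [(x, y)] is trivial exactly when both coordinates are
    ([order_pair]); letting [x] and [y] range over the two groups gives the
    description of the spectrum of the product ([omega_setX]).

    The identity contributes the order 1 to each spectrum, and lcm with 1
    changes nothing, so the spectrum of each factor is contained in that of the
    product: this is the lower bound.  The upper bound holds because the
    spectrum of the product is the image, under lcm, of a set of
    [eta G * eta H] pairs.  When the two group orders are coprime, lcm is
    injective on these pairs: [a] is recovered from [lcm(a, b)] as its gcd with
    the order of the first group, since [a] divides that order and [b] is
    coprime to it ([gcdn_lcm_coprime]); symmetrically for [b]. *)

Lemma mem_omega (gT : finGroupType) (G : {group gT}) n :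
  reflect (exists2 x, x \in G & n = #[x]%g) (n \in omega G).
Proof. exact: imfsetP. Qed.

Lemma one_mem_omega (gT : finGroupType) (G : {group gT}) : 1 \in omega G.
Proof. by apply/mem_omega; exists 1%g; rewrite ?group1 ?order1. Qed.

Lemma dvdn_omega {gT : finGroupType} {G : {group gT}} {n} :
  n \in omega G -> n %| #|G|.
Proof. by case/mem_omega => x Gx ->; apply: order_dvdG. Qed.

Lemma order_pair (gT1 gT2 : finGroupType) (x : gT1) (y : gT2) :
  #[(x, y)]%g = lcmn #[x]%g #[y]%g.
Proof.
have expg_pair n : ((x, y) ^+ n)%g = (x ^+ n, y ^+ n)%g.
  by elim: n => // n IHn; rewrite !expgS IHn.
have dvd_pair n : (#[(x, y)]%g %| n) = (lcmn #[x]%g #[y]%g %| n).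
  by rewrite dvdn_lcm !order_dvdn expg_pair.
by apply/eqP; rewrite eqn_dvd dvd_pair dvdnn -dvd_pair dvdnn.
Qed.

Lemma omega_setX (gT1 gT2 : finGroupType) (G : {group gT1}) (H : {group gT2}) :
  omega (setX_group G H) = [fset lcmn a b | a in omega G, b in omega H]%fset.
Proof.
apply/fsetP => n; apply/mem_omega/imfset2P.
  case=> [[x y]] /setXP[Gx Hy] ->; rewrite order_pair.
  exists #[x]%g; first by apply/mem_omega; exists x.
  by exists #[y]%g => //; apply/mem_omega; exists y.
case=> a /mem_omega[x Gx ->] [b /mem_omega[y Hy ->] ->].
by exists (x, y); rewrite ?order_pair //; apply/setXP.
Qed.

Lemma card_imfset2_leq (K : choiceType) (f : K -> K -> K) (A B : {fset K}) :
  #|` [fset f a b | a in A, b in B]%fset| <= #|` A| * #|` B|.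
Proof.
rewrite -(size_allpairs f); apply: uniq_leq_size => [|k]; first exact: fset_uniq.
by case/imfset2P=> a Aa [b Bb ->]; apply: allpairs_f.
Qed.

Lemma card_in_imfset2 (K : choiceType) (f : K -> K -> K) (A B : {fset K}) :
    {in A & B, forall a b, {in A & B, forall a' b',
       f a b = f a' b' -> a = a' /\ b = b'}} ->
  #|` [fset f a b | a in A, b in B]%fset| = #|` A| * #|` B|.
Proof.
move=> f_inj; rewrite -(size_allpairs f); apply/perm_size/enum_imfset2.
move=> [a b] [a' b'] /andP[Aa Bb] /andP[Aa' Bb'] /= eq_f.
by have [-> ->] := f_inj a b Aa Bb a' b' Aa' Bb' eq_f.
Qed.

(** Gcd with [m] is the inverse of [lcm(-, b)] on the divisors of [m]: as [a]
    is then coprime to [b], the lcm is the product [a * b], and only [a] shares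
    factors with [m]. *)
Lemma gcdn_lcm_coprime m a b : a %| m -> coprime m b -> gcdn (lcmn a b) m = a.
Proof.
move=> a_m co_mb; have co_ab := coprime_dvdl a_m co_mb.
have <-: a * b = lcmn a b by rewrite -muln_lcm_gcd (eqP co_ab) muln1.
by rewrite gcdnC Gauss_gcdl //; apply/gcdn_idPr.
Qed.

Theorem proposition3p3 (gT1 gT2 : finGroupType) (G : {group gT1}) (H : {group gT2}) :
  [/\ omega (setX_group G H)
        = [fset lcmn a b | a in omega G, b in omega H]%fset,
      maxn (eta G) (eta H) <= eta (setX_group G H) <= eta G * eta H
    & coprime #|G| #|H| -> eta (setX_group G H) = eta G * eta H].
Proof.
split; first exact: omega_setX.
  rewrite /eta omega_setX card_imfset2_leq geq_max andbT.
  apply/andP; split; apply: fsubset_leq_card; apply/fsubsetP => n omega_n.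
    by rewrite -[n]lcmn1; apply: in_imfset2 => //; apply: one_mem_omega.
  by rewrite -[n]lcm1n; apply: in_imfset2 => //; apply: one_mem_omega.
move=> co_GH; rewrite /eta omega_setX; apply: card_in_imfset2.
have lcm_inv a b : a \in omega G -> b \in omega H ->
    gcdn (lcmn a b) #|G| = a /\ gcdn (lcmn a b) #|H| = b.
  move=> /dvdn_omega a_G /dvdn_omega b_H.
  have co_Gb := coprime_dvdr b_H co_GH.
  have co_Ha: coprime #|H| a by rewrite coprime_sym (coprime_dvdl a_G).
  by split; last rewrite lcmnC; apply: gcdn_lcm_coprime.
move=> a b Ga Hb a' b' Ga' Hb' eq_lcm.
have := lcm_inv a b Ga Hb; rewrite eq_lcm.
by have [-> ->] := lcm_inv a' b' Ga' Hb' => - [-> ->].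
Qed.
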